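(* Let $\mathsf{C}$ be a locally small category and let $(A_i,a_i)_{i\in\mathbb{N}}$, $(B_k,b_k)_{k\in\mathbb{N}}$ be two sequences in $\mathsf{C}$ with colimits $(A,\overline{a}_i)_{i\in\mathbb{N}}$ and $(B,\overline{b}_k)_{k\in\mathbb{N}}$, respectively. If $(A_i,a_i)_{i\in\mathbb{N}}$ and $(B_k,b_k)_{k\in\mathbb{N}}$ are confluent, then $A$ and $B$ are isomorphic.
   Context: $\mathbb{N}=\{1,2,3,\ldots\}$. A sequence $(A_i,a_i)_{i\in\mathbb{N}}$ in $\mathsf{C}$ consists of objects $A_i$ and arrows $a_i\colon A_i\to A_{i+1}$, $i\in\mathbb{N}$. For $i<j$ put $a_{ij}:=a_{j-1}\circ\cdots\circ a_{i+1}\circ a_i\colon A_i\to A_j$, and let $a_{ii}$ be the identity of $A_i$. The colimit of the sequence is the colimit (universal cocone) $(A,\overline{a}_i)$ of the directed diagram $(A_i,a_{ij})_{i,j\in\mathbb{N}}$, where $A$ is the colimit object and $\overline{a}_i\colon A_i\to A$ are the colimit morphisms. The same conventions apply to $(B_k,b_k)_{k\in\mathbb{N}}$, with $b_{kl}$ and $\overline{b}_k$. Confluence. The two sequences are confluent if there exist integers $0<i_1<i_2<\cdots$ and $0<k_1<k_2<\cdots$, together with $\mathsf{C}$-arrows $f_n\colon A_{i_n}\to B_{k_n}$ and $g_n\colon B_{k_n}\to A_{i_{n+1}}$ for each $n\in\mathbb{N}$, such that $a_{i_n i_{n+1}}=g_n\circ f_n$ and $b_{k_n k_{n+1}}=f_{n+1}\circ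 g_n$ for all $n\in\mathbb{N}$. *)

(* Defs.v *)
From mathcomp Require Import all_boot.

Set Implicit Arguments.
Unset Strict Implicit.
Unset Printing Implicit Defensive.

(* Local smallness: objects and arrows live in two unrelated universes, so the
   collection of objects may be large while each [hom X Y] is a single type;
   arrows are compared by Leibniz equality. *)
Record category : Type := Category {
  ob :> Type;
  hom : ob -> ob -> Type;
  idm : forall X, hom X X;
  comp : forall X Y Z, hom Y Z -> hom X Y -> hom X Z;
  comp1m : forall X Y (f : hom X Y), comp (idm Y) f = f;
  compm1 : forall X Y (f : hom X Y), comp f (idm X) = f;
  compmA : forall X Y Z W (h : hom Z W) (g : hom Y Z) (f : hom X Y),
    comp h (comp g f) = comp (comp h g) f
}.

Arguments idm {c} X.

Declare Scope cat_scope.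
Delimit Scope cat_scope with cat.
Notation "g ∘ f" := (comp g f) (at level 40, left associativity) : cat_scope.
Local Open Scope cat_scope.

Definition isomorphic (C : category) (X Y : C) : Prop :=
  exists (u : hom X Y) (v : hom Y X), v ∘ u = idm X /\ u ∘ v = idm Y.

(* The index set {1, 2, 3, ...} is represented by [nat], the index n standing
   for the mathematical index n + 1. *)
Record sequence (C : category) : Type := Sequence {
  sob :> nat -> C;
  sarr : forall i, hom (sob i) (sob i.+1)
}.

Definition stail (C : category) (A : sequence C) : sequence C :=
  Sequence (fun i => sarr A i.+1).

Fixpoint smap0 (C : category) (A : sequence C) (j : nat) : hom (A 0) (A j) :=
  if j is j'.+1 then sarr A j' ∘ smap0 A j' else idm (A 0).

(* a_ij = a_(j-1) ∘ ... ∘ a_i for i <= j, with a_ii the identity. Dropping the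
   first i terms reduces to i = 0 without transporting along equalities of
   indices; [smapnn] and [smapS] below are the expected equations. *)
Fixpoint smap (C : category) (A : sequence C) (i j : nat) {struct i} :
    i <= j -> hom (A i) (A j) :=
  match i, j return i <= j -> hom (A i) (A j) with
  | 0, j' => fun=> smap0 A j'
  | i'.+1, 0 => fun le_ij => False_rect _ (notF le_ij)
  | i'.+1, j'.+1 => fun le_ij => @smap C (stail A) i' j' le_ij
  end.

Lemma smapnn (C : category) (A : sequence C) i (le_ii : i <= i) :
  smap A le_ii = idm (A i).
Proof. by elim: i A le_ii => [|i IHi] A le_ii //=; apply: (IHi (stail A)). Qed.

Lemma smapS (C : category) (A : sequence C) i j
    (le_ij : i <= j) (le_ij1 : i <= j.+1) :
  smap A le_ij1 = sarr A j ∘ smap A le_ij.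
Proof.
by elim: i j A le_ij le_ij1 => [|i IHi] [|j] A le_ij le_ij1 //=;
  apply: (IHi j (stail A)).
Qed.

Definition is_cocone (C : category) (A : sequence C) (X : C)
    (c : forall i, hom (A i) X) : Prop :=
  forall i j (le_ij : i <= j), c j ∘ smap A le_ij = c i.

Definition is_colimit (C : category) (A : sequence C) (L : C)
    (l : forall i, hom (A i) L) : Prop :=
  is_cocone l /\
  forall (X : C) (c : forall i, hom (A i) X), is_cocone c ->
    exists! u : hom L X, forall i, u ∘ l i = c i.

Definition confluent (C : category) (A B : sequence C) : Prop :=
  exists (i k : nat -> nat)
         (lt_i : forall n, i n < i n.+1) (lt_k : forall n, k n < k n.+1)
         (f : forall n, hom (A (i n)) (B (k n)))
         (g : forall n, hom (B (k n)) (A (i n.+1))),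
    forall n, smap A (ltnW (lt_i n)) = g n ∘ f n /\
              smap B (ltnW (lt_k n)) = f n.+1 ∘ g n.

(* Main.v *)
(* A colimit of a sequence is determined by its restriction to any strictly
   increasing sequence of indices i_0 < i_1 < ...: a compatible family f_n on
   the A_(i_n) extends to a cocone through the maps A_m -> A_(i_m), which exist
   because m <= i_m. Hence the families bbar_(k_n) f_n and abar_(i_(n+1)) g_n
   induce arrows A -> B and B -> A, and the relations between f and g make these
   mutually inverse after composition with every abar_(i_n) and bbar_(k_n). *)
From mathcomp Require Import all_boot.
Require Import Defs.

Local Open Scope cat_scope.

Lemma smap_comp (C : category) (A : sequence C) i j k
    (le_ij : i <= j) (le_jk : j <= k) (le_ik : i <= k) :
  smap A le_jk ∘ smap A le_ij = smap A le_ik.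
Proof.
elim: k le_jk le_ik => [|k IHk] le_jk le_ik.
  have j0 : j = 0 by move: le_jk; rewrite leqn0 => /eqP.
  subst j; rewrite smapnn comp1m.
  by congr smap; apply: bool_irrelevance.
have := le_jk; rewrite leq_eqVlt => /orP[/eqP def_j|lt_jk].
  subst j; rewrite smapnn comp1m.
  by congr smap; apply: bool_irrelevance.
have le_jk' : j <= k := lt_jk; have le_ik' := leq_trans le_ij le_jk'.
by rewrite (smapS _ le_jk') (smapS _ le_ik') -compmA (IHk _ le_ik').
Qed.

(** Induction on [j] peels the last arrow off [smap A le_ij]. *)
Lemma is_cocone_step (C : category) (A : sequence C) (X : C)
    (c : forall i, hom (A i) X) :
  (forall i, c i.+1 ∘ smap A (leqnSn i) = c i) -> is_cocone c.
Proof.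
move=> cS i; elim=> [|j IHj] le_ij.
  have i0 : i = 0 by move: le_ij; rewrite leqn0 => /eqP.
  by subst i; rewrite smapnn compm1.
have := le_ij; rewrite leq_eqVlt => /orP[/eqP def_i|lt_ij].
  by subst i; rewrite smapnn compm1.
have le_ij' : i <= j := lt_ij.
by rewrite -(smap_comp _ _ _ _ _ le_ij' (leqnSn j)) compmA cS IHj.
Qed.

Lemma leq_increasing (i : nat -> nat) :
  (forall n, i n < i n.+1) -> forall n, n <= i n.
Proof. by move=> lt_i; elim=> // n IHn; apply: leq_ltn_trans (lt_i n). Qed.

Section Subsequence.

Variables (C : category) (A : sequence C) (L : C) (l : forall i, hom (A i) L).
Hypothesis colimL : is_colimit l.
Variable i : nat -> nat.
Hypothesis lt_i : forall n, i n < i n.+1.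

Lemma colimit_subseq_factor (X : C) (f : forall n, hom (A (i n)) X) :
    (forall n, f n.+1 ∘ smap A (ltnW (lt_i n)) = f n) ->
  exists u : hom L X, forall n, u ∘ l (i n) = f n.
Proof.
move=> fS; pose le_i := leq_increasing i lt_i.
have cP : is_cocone (fun m => f m ∘ smap A (le_i m)).
  (* Both sides are compared along $A_m \to A_{i_{m+1}}$, which factors through $A_{m+1}$ and
     through $A_{i_m}$. *)
  apply: is_cocone_step => m; have le_mi := leq_trans (le_i m) (ltnW (lt_i m)).
  rewrite -compmA (smap_comp _ _ _ _ _ _ _ le_mi).
  by rewrite -(smap_comp _ _ _ _ _ (le_i m) (ltnW (lt_i m))) compmA fS.
have [_ /(_ X _ cP)[u [uP _]]] := colimL; exists u => n.
(* At index [i n] the cocone is [f (i n)] after $A_{i_n} \to A_{i_{i_n}}$, not [f n] itself; [fP]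
   with [m := i n] identifies the two. *)
have fP (m : nat) : n <= m -> forall le_nm : i n <= i m,
    f m ∘ smap A le_nm = f n.
  elim: m => [|m IHm].
    by rewrite leqn0 => /eqP-> le_nm; rewrite smapnn compm1.
  rewrite leq_eqVlt => /orP[/eqP<- le_nm|lt_nm le_nm].
    by rewrite smapnn compm1.
  have le_inm : i n <= i m.
    apply: (@homo_leq _ i leq leqnn _ _ n m lt_nm) => [p q r|p].
      exact: leq_trans.
    exact: ltnW.
  by rewrite -(smap_comp _ _ _ _ _ le_inm (ltnW (lt_i m))) compmA fS IHm.
by rewrite uP fP.
Qed.

(** Since [m <= i m], every [l m] factors through [l (i m)], so both arrows mediate the cocone
    [v ∘ l m]. *)
Lemma colimit_subseq_ext (X : C) (u v : hom L X) :
  (forall n, u ∘ l (i n) = v ∘ l (i n)) -> u = v.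
Proof.
move=> uv; have [l_cocone l_univ] := colimL.
have cP : is_cocone (fun m => v ∘ l m).
  by move=> m n le_mn; rewrite -compmA l_cocone.
have [w [_ w_uniq]] := l_univ X _ cP.
have le_i := leq_increasing i lt_i.
have <- : w = v by apply: w_uniq.
by apply/esym/w_uniq => m; rewrite -(l_cocone _ _ (le_i m)) !compmA uv.
Qed.

End Subsequence.

Theorem theorem2p1 (C : category) (A_ B_ : sequence C)
    (A : C) (abar : forall i, hom (A_ i) A)
    (B : C) (bbar : forall k, hom (B_ k) B)
    (colimA : is_colimit abar) (colimB : is_colimit bbar)
    (conf : confluent A_ B_) :
  isomorphic A B.
Proof.
have [i [k [lt_i [lt_k [f [g fgP]]]]]] := conf.
have gf n : g n ∘ f n = smap A_ (ltnW (lt_i n)) by have [] := fgP n.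
have fg n : f n.+1 ∘ g n = smap B_ (ltnW (lt_k n)) by have [] := fgP n.
have [abarP _] := colimA; have [bbarP _] := colimB.
have [n|u uP] := colimit_subseq_factor _ _ _ _ colimA i lt_i
  _ (fun n => bbar (k n) ∘ f n).
  (* Regrouping $f_{n+1} g_n f_n$ turns $f_{n+1} g_n$ into a connecting map of [B_], which [bbar]
     absorbs. *)
  by rewrite -gf -compmA (compmA (f n.+1)) fg compmA bbarP.
have [n|v vP] := colimit_subseq_factor _ _ _ _ colimB k lt_k
  _ (fun n => abar (i n.+1) ∘ g n).
  by rewrite -fg -compmA (compmA (g n.+1)) gf compmA abarP.
exists u, v; split.
  apply: (colimit_subseq_ext _ _ _ _ colimA i lt_i) => n.
  (* $v u \overline{a}_{i_n} = v \overline{b}_{k_n} f_n = \overline{a}_{i_{n+1}} g_n f_n =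
     \overline{a}_{i_n}$. *)
  by rewrite comp1m -compmA uP compmA vP -compmA gf abarP.
apply: (colimit_subseq_ext _ _ _ _ colimB k lt_k) => n.
by rewrite comp1m -compmA vP compmA uP -compmA fg bbarP.
Qed.
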